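(* Let $H$ be a separable infinite-dimensional complex Hilbert space. If the collection of $\ell^1$-bounded subsets of $H$ is closed under finite unions, then the following statements hold. (a) Every Bessel sequence in $H$ (and hence every frame for $H$) is $\ell^1$-bounded. (b) $\ell^1$-frame-boundedness is equivalent to $\ell^1$-boundedness in $H$; that is, a subset $M\subseteq H$ is $\ell^1$-frame-bounded if and only if it is $\ell^1$-bounded. (c) If $\mathcal{E}$ is a Riesz basis for $H$, then there exists another Riesz basis $\mathcal{R}$ for $H$ such that $H_{\mathcal{E}}\subsetneq H_{\mathcal{R}}$. (d) Every unconditionally summable sequence in $H$ is $\ell^1$-bounded.
   Context: A sequence $\{e_n\}_{n\in\mathbb{N}}$ in $H$ is a Riesz basis for $H$ if it is the image of an orthonormal basis under a bounded invertible linear operator. A sequence $\{x_n\}$ is a Bessel sequence if there is $B>0$ with $\sum_n|\langle x,x_n\rangle|^2\le B\|x\|^2$ for all $x\in H$; it is a frame for $H$ if there are constants $0<A\le B$ with $A\|x\|^2\le\sum_n|\langle x,x_n\rangle|^2\le B\|x\|^2$ for all $x\in H$. For a Riesz basis or frame $\mathcal{E}=\{e_n\}$ and $x\in H$, put $\|x\|_{1,\mathcal{E}}=\sum_n|\langle x,e_n\rangle|\in[0,\infty]$ and $H_{\mathcal{E}}=\{x\in H:\|x\|_{1,\mathcal{E}}<\infty\}$. A subset $M\subseteq H$ is $\ell^1$-bounded if $\sup_{x\in M}\|x\|_{1,\mathcal{E}}<\infty$ for some Riesz basis $\mathcal{E}$ for $H$, and $\ell^1$-frame-bounded if $\sup_{x\in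 M}\|x\|_{1,\mathcal{F}}<\infty$ for some frame $\mathcal{F}$ for $H$. A sequence is called $\ell^1$-bounded if its set of terms is. A sequence $\{x_n\}$ is unconditionally summable if $\sum_n x_n$ converges unconditionally in $H$ (i.e. converges for every ordering of the index set). *)

(* Defs.v *)
From HB Require Import structures.
From mathcomp Require Import all_boot all_order all_algebra.
From mathcomp Require Export sesquilinear complex.
From mathcomp Require Import all_classical all_reals all_analysis.

Set Implicit Arguments.
Unset Strict Implicit.
Unset Printing Implicit Defensive.
Import Order.TTheory GRing.Theory Num.Theory.
Import numFieldNormedType.Exports.
Local Open Scope classical_set_scope.
Local Open Scope ring_scope.

(* `|x| : R[i] has zero imaginary part; this is the same number in R. It is
   used for vectors of H as well as for scalars, where `|z| is the modulus. *)
Definition rnorm {R : realType} {V : normedZmodType R[i]} (x : V) : R :=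
  complex.Re `|x|.

Section Hilbert.
Context {R : realType} {H : completeNormedModType R[i]}.

(* The norm of H takes values in R[i], so both sides live in R[i]. *)
Definition induces_norm (dot : {dot H for (@Num.conj R[i])}) : Prop :=
  forall x : H, `|x| ^+ 2 = dot x x.

Definition lin_span (A : set H) : set H :=
  [set x | exists (n : nat) (a : 'I_n -> R[i]) (v : 'I_n -> H),
     (forall i, A (v i)) /\ x = \sum_(i < n) a i *: v i].

Definition bounded_op (T : H -> H) : Prop :=
  exists M : R, forall x, rnorm (T x) <= M * rnorm x.

Definition unconditionally_summable (x : nat -> H) : Prop :=
  forall s : nat -> nat, bijective s -> cvgn (series (x \o s)).

Context (dot : {dot H for (@Num.conj R[i])}).

Definition orthonormal_basis (u : nat -> H) : Prop :=
  (forall m n : nat, dot (u m) (u n) = (m == n)%:R) /\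
  dense (lin_span (range u)).

Definition riesz_basis (e : nat -> H) : Prop :=
  exists (u : nat -> H) (T S : {linear H -> H}),
    [/\ orthonormal_basis u, bounded_op T, bounded_op S,
        cancel T S /\ cancel S T & forall n, e n = T (u n)].

Definition bessel_bound (B : R) (e : nat -> H) : Prop :=
  forall x : H,
    (\sum_(0 <= n <oo) (rnorm (dot x (e n)) ^+ 2)%:E
       <= (B * rnorm x ^+ 2)%:E)%E.

Definition bessel (e : nat -> H) : Prop :=
  exists B : R, 0 < B /\ bessel_bound B e.

Definition frame (e : nat -> H) : Prop :=
  exists A B : R, [/\ 0 < A, A <= B, bessel_bound B e &
    forall x : H,
      ((A * rnorm x ^+ 2)%:E
         <= \sum_(0 <= n <oo) (rnorm (dot x (e n)) ^+ 2)%:E)%E].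

Definition l1norm (e : nat -> H) (x : H) : \bar R :=
  (\sum_(0 <= n <oo) (rnorm (dot x (e n)))%:E)%E.

Definition l1space (e : nat -> H) : set H := [set x | (l1norm e x < +oo)%E].

Definition l1_bounded (M : set H) : Prop :=
  exists e : nat -> H, riesz_basis e /\ (ereal_sup (l1norm e @` M) < +oo)%E.

Definition l1_frame_bounded (M : set H) : Prop :=
  exists f : nat -> H, frame f /\ (ereal_sup (l1norm f @` M) < +oo)%E.

End Hilbert.

Definition separable (T : topologicalType) : Prop :=
  exists A : set T, countable A /\ dense A.

Definition infinite_dimensional {R : realType}
    (H : completeNormedModType R[i]) : Prop :=
  forall A : set H, finite_set A -> lin_span A <> setT.

(* Main.v *)
From HB Require Import structures.
Require Import Defs.
From mathcomp Require Import all_boot all_order all_algebra.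
From mathcomp Require Import all_classical all_reals all_analysis.
From mathcomp Require Import ring lra.

Set Implicit Arguments.
Unset Strict Implicit.
Unset Printing Implicit Defensive.
Import Order.TTheory GRing.Theory Num.Theory.
Import numFieldNormedType.Exports.
Local Open Scope classical_set_scope.
Local Open Scope ring_scope.

(** Everything reduces to Bessel sequences.  Fix an orthonormal basis [u], which
    exists by Gram-Schmidt.  A Bessel sequence [f] is the image [T (u n)] of [u] by
    a bounded operator, and [T = W + k] where, for [k] larger than the norm of [T],
    both [W] and multiplication by [k] are invertible
    ([bessel_riesz_decomposition]).  Thus [f n = W (u n) + k u n] is a sum of terms
    of two Riesz bases.  A Riesz basis is l1-bounded, as measured by its
    biorthogonal basis ([riesz_basis_l1_bounded]); by closure under unions a single
    Riesz basis bounds both, and by the triangle inequality it bounds [f]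
    ([bessel_l1_bounded]).

    The other claims follow.  If a frame [f] bounds [M], then each [x] in [M] is
    the sum of [<x, f k> g k] for a Bessel dual frame [g] ([frame_dual]).  The
    coefficients are absolutely summable, uniformly over [M], and the [g k] are
    l1-bounded by some Riesz basis, so this basis bounds [M] ([l1_series_le]).  Given a
    Riesz basis [e] with biorthogonal basis [h], let [y] be the sum of
    [h n / (n + 1)]: it is not in the l1 space of [e], and a Riesz basis bounding
    the Bessel sequence [y, h 0, h 1, ...] has an l1 space that contains [y] and
    the l1 space of [e] ([l1space_proper_extension]).  Finally, an unconditionally
    summable sequence has bounded finite subsums, hence is Bessel
    ([unconditional_bessel]).

    The analysis rests on two facts about Bessel sequences: synthesis of
    square-summable coefficients converges, with the Bessel constant
    ([bessel_synth]), and analysis by one Bessel sequence followed by synthesis by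
    another is a bounded operator whose adjoint exchanges the two ([mixed_op],
    [mixed_op_adjoint]).  Inverses come from Neumann series ([neumann]). *)

(** * Norms and inner products with real values *)

Section RealNorm.
Context {R : realType}.
Local Notation C := (R[i]).

Section Normed.
Context {V : normedZmodType C}.
Implicit Types x y : V.

Lemma rnormE x : (rnorm x)%:C%C = `|x|.
Proof. by rewrite /rnorm RRe_real // normr_real. Qed.

Lemma rnorm_ge0 x : 0 <= rnorm x.
Proof. by rewrite -ler0c rnormE. Qed.

Lemma rnorm0 : rnorm (0 : V) = 0.
Proof. by apply: complexI; rewrite rnormE normr0. Qed.

Lemma rnorm0_eq0 x : rnorm x = 0 -> x = 0.
Proof. by move=> x0; apply/normr0_eq0; rewrite -rnormE x0. Qed.

Lemma rnormN x : rnorm (- x) = rnorm x.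
Proof. by rewrite /rnorm normrN. Qed.

Lemma rnormBC x y : rnorm (x - y) = rnorm (y - x).
Proof. by rewrite -rnormN opprB. Qed.

Lemma rnormD x y : rnorm (x + y) <= rnorm x + rnorm y.
Proof. by rewrite -lecR rmorphD /= !rnormE ler_normD. Qed.

Lemma rnormB x y : rnorm (x - y) <= rnorm x + rnorm y.
Proof. by rewrite -(rnormN y) rnormD. Qed.

Lemma rnorm_sum I (r : seq I) (P : pred I) (F : I -> V) :
  rnorm (\sum_(i <- r | P i) F i) <= \sum_(i <- r | P i) rnorm (F i).
Proof.
elim/big_rec2: _ => [|i b a _ ab]; first by rewrite rnorm0.
by rewrite (le_trans (rnormD _ _)) // lerD2l.
Qed.

End Normed.

Lemma rnormZ {V : normedModType C} (a : C) (x : V) :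
  rnorm (a *: x) = rnorm a * rnorm x.
Proof. by apply: complexI; rewrite rmorphM /= !rnormE normrZ. Qed.

Lemma rnormM (a b : C) : rnorm (a * b) = rnorm a * rnorm b.
Proof. by apply: complexI; rewrite rmorphM /= !rnormE normrM. Qed.

Lemma rnorm_conj (a : C) : rnorm a^* = rnorm a.
Proof. by apply: complexI; rewrite !rnormE norm_conjC. Qed.

Lemma rnorm_real (a : R) : rnorm (a%:C%C) = `|a|.
Proof. by apply: complexI; rewrite rnormE normc_def /= expr0n addr0 sqrtr_sqr. Qed.

Lemma conj_realC (a : R) : (a%:C%C)^* = a%:C%C :> C.
Proof. exact: conjc_real. Qed.

Lemma mul_conj_rnorm (a : C) : a * a^* = ((rnorm a) ^+ 2)%:C%C.
Proof. by rewrite rmorphXn /= rnormE normCK. Qed.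

Lemma rnorm_sqrE (a : C) : rnorm a ^+ 2 = complex.Re a ^+ 2 + complex.Im a ^+ 2.
Proof.
by apply: complexI; rewrite rmorphXn /= rnormE -add_Re2_Im2.
Qed.

Lemma Re_le_rnorm (a : C) : `|complex.Re a| <= rnorm a.
Proof. by rewrite -lecR rnormE normc_ge_Re. Qed.

Lemma Im_le_rnorm (a : C) : `|complex.Im a| <= rnorm a.
Proof.
rewrite -(@ler_pXn2r _ 2) ?nnegrE ?rnorm_ge0 //.
by rewrite rnorm_sqrE real_normK ?num_real // lerDr sqr_ge0.
Qed.

Lemma rnorm_le_ReIm (a : C) : rnorm a <= `|complex.Re a| + `|complex.Im a|.
Proof.
rewrite -(@ler_pXn2r _ 2) ?nnegrE ?addr_ge0 ?rnorm_ge0 //.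
rewrite rnorm_sqrE sqrrD !real_normK ?num_real // lerD2r lerDl.
by rewrite mulrn_wge0 ?mulr_ge0.
Qed.

End RealNorm.

Section InnerProduct.
Context {R : realType} {H : completeNormedModType R[i]}.
Variable dot : {dot H for (@Num.conj R[i])}.
Hypothesis hdot : induces_norm dot.
Implicit Types x y z : H.

Lemma dotC x y : dot y x = (dot x y)^*.
Proof. by rewrite hermC /= expr0 mul1r. Qed.

Lemma dotxx x : dot x x = (rnorm x ^+ 2)%:C%C.
Proof. by rewrite -hdot rmorphXn /= rnormE. Qed.

Lemma dot_suml I (r : seq I) (P : pred I) (F : I -> H) y :
  dot (\sum_(i <- r | P i) F i) y = \sum_(i <- r | P i) dot (F i) y.
Proof. exact: linear_sumlz. Qed.

Lemma dot_sumr I (r : seq I) (P : pred I) (F : I -> H) y :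
  dot y (\sum_(i <- r | P i) F i) = \sum_(i <- r | P i) dot y (F i).
Proof. exact: linear_sumr. Qed.

Lemma dotZl a x y : dot (a *: x) y = a * dot x y.
Proof. exact: linearZl_LR. Qed.

Lemma dotZr a x y : dot x (a *: y) = a^* * dot x y.
Proof. exact: linearZr_LR. Qed.

Lemma rnorm_sqrD x y :
  rnorm (x + y) ^+ 2 = rnorm x ^+ 2 + rnorm y ^+ 2 + 2 * complex.Re (dot x y).
Proof.
apply: complexI; rewrite -dotxx dnormD !dotxx !(rmorphD (real_complex R)) /=.
by congr (_ + _); rewrite rmorphM rmorph_nat; exact: addcJ.
Qed.

Lemma dot_inj x y : (forall z, dot x z = dot y z) -> x = y.
Proof.
move=> xy; apply/eqP; rewrite -subr_eq0 -(dnorm_eq0 dot) linearBl /=.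
by rewrite xy subrr.
Qed.

Lemma CauchySchwarz x y : rnorm (dot x y) <= rnorm x * rnorm y.
Proof.
have [->|y0] := eqVneq y 0; first by rewrite linear0r !rnorm0 mulr0.
have ny : 0 < rnorm y.
  rewrite lt_neqAle rnorm_ge0 andbT eq_sym; apply: contra_neq y0; exact: rnorm0_eq0.
(* The square of the norm of the component of x orthogonal to y is
   nonnegative. *)
pose a := - (dot x y / dot y y).
have := sqr_ge0 (rnorm (x + a *: y)).
rewrite rnorm_sqrD rnormZ dotZr.
set d := dot x y.
have -> : a^* * d = (- (rnorm d ^+ 2 / rnorm y ^+ 2))%:C%C.
  rewrite /a dotxx -/d -fmorphV rmorphN rmorphM /=. rewrite conj_realC mulNr mulrAC.
  by rewrite [_^* * d]mulrC mul_conj_rnorm -rmorphM -rmorphN.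
have -> : rnorm a = rnorm d / rnorm y ^+ 2.
  rewrite /a rnormN rnormM dotxx -fmorphV /= rnorm_real ger0_norm //.
  by rewrite invr_ge0 exprn_ge0 // rnorm_ge0.
move=> /= h; rewrite -(@ler_pXn2r _ 2) ?nnegrE ?mulr_ge0 ?rnorm_ge0 //.
have : 0 <= rnorm x ^+ 2 - rnorm d ^+ 2 / rnorm y ^+ 2.
  apply: le_trans h _; rewrite le_eqVlt; apply/orP; left; apply/eqP.
  by field; rewrite gt_eqF.
by rewrite subr_ge0 ler_pdivrMr ?exprn_gt0 // exprMn.
Qed.

End InnerProduct.

(** * Limits and bounded operators *)

Lemma cvg_rnormP {R : realType} {V : normedModType R[i]} (s : nat -> V) (l : V) :
  s @ \oo --> l <->
  forall e : R, 0 < e -> \forall n \near \oo, rnorm (l - s n) < e.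
Proof.
split=> [/cvgrPdist_lt sl e e0|sl].
  have e0' : 0 < e%:C%C by rewrite ltcR.
  by apply: filterS (sl _ e0') => n; rewrite -rnormE ltcR.
apply/cvgrPdist_lt => e e0.
have eE : e = (complex.Re e)%:C%C by rewrite RRe_real // gtr0_real.
rewrite eE ltcR in e0; apply: filterS (sl _ e0) => n.
by rewrite eE -rnormE ltcR.
Qed.

Lemma cvg_rnorm {R : realType} {V : normedModType R[i]} (s : nat -> V) (l : V) :
  s @ \oo --> l -> (rnorm \o s) @ \oo --> rnorm l.
Proof.
move=> /cvg_rnormP sl; apply/cvgrPdist_lt => e /sl; apply: filterS => n.
apply: le_lt_trans; rewrite ler_norml.
have := rnormD (s n - l) l; have := rnormD (l - s n) (s n).
by rewrite !subrK rnormBC => *; apply/andP; split; lra.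
Qed.

Section Limits.
Context {R : realType} {H : completeNormedModType R[i]}.
Implicit Types (x y l : H) (s : nat -> H).

Lemma cauchy_rnorm s :
  (forall e : R, 0 < e ->
     exists N, forall m n, (N <= m <= n)%N -> rnorm (s n - s m) < e) ->
  cvgn s.
Proof.
move=> cs; apply/cauchy_cvgP/cauchy_ballP => e e0.
have eE : e = (complex.Re e)%:C%C by rewrite RRe_real // gtr0_real.
rewrite eE ltcR in e0; have [N sN] := cs _ e0.
exists (s @` [set n | (N <= n)%N], s @` [set n | (N <= n)%N]).
  by split; exists N => //= n Nn; exists n.
move=> [_ _] [/= [m Nm <-] [n Nn <-]] /=.
rewrite -ball_normE /ball_ /= eE -rnormE ltcR.
have [mn|/ltnW nm] := leqP m n; last by apply: sN; rewrite Nn.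
by rewrite rnormBC; apply: sN; rewrite Nm.
Qed.

Lemma rnorm_lim_le s l (c : R) :
  s @ \oo --> l -> (forall n, rnorm (s n) <= c) -> rnorm l <= c.
Proof.
move=> /cvg_rnorm sl sc; have <- := cvg_lim (@Rhausdorff R) sl.
by apply: limr_le; [apply/cvg_ex; exists (rnorm l)|apply: nearW].
Qed.

Lemma cvg_bounded_op (T : {linear H -> H}) s l :
  bounded_op T -> s @ \oo --> l -> (T \o s) @ \oo --> T l.
Proof.
move=> [M TM] /cvg_rnormP sl; apply/cvg_rnormP => e e0.
have M0 : 0 < `|M| + 1 by rewrite ltr_wpDl.
have := sl _ (divr_gt0 e0 M0); apply: filterS => n.
rewrite ltr_pdivlMr // mulrC; apply: le_lt_trans.
rewrite -linearB; apply: le_trans (TM _) _.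
by rewrite ler_wpM2r ?rnorm_ge0 // (le_trans (ler_norm M)) // lerDl.
Qed.

Lemma cvg_rnorm_unique s l l' : s @ \oo --> l -> s @ \oo --> l' -> l = l'.
Proof. by move=> sl sl'; apply: cvg_unique sl sl'. Qed.

Lemma bounded_op_ge0 (T : H -> H) : bounded_op T ->
  exists2 M : R, 0 <= M & forall x, rnorm (T x) <= M * rnorm x.
Proof.
move=> [M TM]; exists `|M| => // x; apply: le_trans (TM x) _.
by rewrite ler_wpM2r ?rnorm_ge0 ?ler_norm.
Qed.

Lemma linear_ext (f : H -> H) : linear f -> exists T : {linear H -> H}, T =1 f.
Proof.
move=> lf; pose T := HB.pack_for {linear H -> H} f (GRing.isLinear.Build _ H H _ f lf).
by exists T.
Qed.

(** The inverse of a linear bijection that is bounded below is linear and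
    bounded. *)
Lemma bounded_inverse (T : {linear H -> H}) (c : R) : 0 < c ->
  (forall x, c * rnorm x <= rnorm (T x)) -> (forall y, exists x, T x = y) ->
  exists S : {linear H -> H}, [/\ bounded_op S, cancel T S & cancel S T].
Proof.
move=> c0 Tc /choice[S0 S0K].
have Tinj : injective T.
  move=> x y Txy; apply/eqP; rewrite -subr_eq0; apply/eqP/rnorm0_eq0/eqP.
  rewrite eq_le rnorm_ge0 andbT -(pmulr_rle0 _ c0) (le_trans (Tc _)) //.
  by rewrite linearB Txy /= subrr rnorm0.
have [|S SE] := @linear_ext S0.
  by move=> a x y; apply: Tinj; rewrite linearP /= !S0K.
exists S; split=> [|x|y]; rewrite ?SE //; last by apply: Tinj; rewrite S0K.
exists c^-1 => y; rewrite SE mulrC ler_pdivlMr // mulrC.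
by rewrite -{2}(S0K y).
Qed.

Lemma denseP (A : set H) : dense A <->
  forall x (e : R), 0 < e -> exists2 a, A a & rnorm (x - a) < e.
Proof.
split=> [dA x e e0|dA O [x Ox] oO].
  have e0' : 0 < e%:C%C by rewrite ltcR.
  have [|a [xa Aa]] := dA (ball x e%:C%C) _ (ball_open _ e%:C%C).
    by exists x; apply: ballxx.
  by exists a => //; move: xa; rewrite -ball_normE /ball_ /= -rnormE ltcR.
have /nbhs_ballP[e /= e0 eO] : nbhs x O by apply: open_nbhs_nbhs; split.
have eE : e = (complex.Re e)%:C%C by rewrite RRe_real // gtr0_real.
rewrite eE ltcR in e0; have [a Aa xa] := dA x _ e0.
exists a; split => //; apply: eO.
by rewrite -ball_normE /ball_ /= eE -rnormE ltcR.
Qed.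

(** Neumann series: the identity minus a strict contraction is onto. *)
Lemma neumann (P : {linear H -> H}) (q : R) : 0 <= q -> q < 1 ->
  (forall x, rnorm (P x) <= q * rnorm x) ->
  forall y, exists x, x - P x = y.
Proof.
move=> q0 q1 Pq y.
have Pk k : rnorm (iter k P y) <= q ^+ k * rnorm y.
  elim: k => [|k IH] /=; first by rewrite mul1r.
  by apply: le_trans (Pq _) _; rewrite exprS -mulrA ler_wpM2l.
pose s n := \sum_(0 <= k < n) iter k P y.
have sS n : s n - P (s n) = y - iter n P y.
  rewrite /s linear_sum -sumrB; elim: n => [|n IH].
    by rewrite big_geq // subrr.
  by rewrite big_nat_recr //= IH addrA subrK.
have q1' : 0 < 1 - q by rewrite subr_gt0.
(* On [s n - s m] the operator 1 - P has the small value P^m y - P^n y, and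
   it is bounded below by 1 - q. *)
have q1N : `|q| < 1 by rewrite ger0_norm.
have sB m n : (m <= n)%N -> rnorm (s n - s m) <= q ^+ m * (2 * rnorm y / (1 - q)).
  move=> mn; rewrite mulrA ler_pdivlMr // mulrC.
  have : rnorm (s n - s m - P (s n - s m)) <= q ^+ m * (2 * rnorm y).
    have -> : s n - s m - P (s n - s m) = (s n - P (s n)) - (s m - P (s m)).
      by rewrite linearB !opprB addrACA [RHS]addrACA [- s m - _]addrC.
    rewrite !sS opprB addrC addrA subrK.
    apply: le_trans (rnormB _ _) _.
    rewrite mulrCA mulr_natl mulr2n lerD ?Pk //.
    apply: le_trans (Pk _) _; rewrite ler_wpM2r ?rnorm_ge0 //.
    by rewrite ler_wiXn2l // ltW.
  move: (s n - s m) => z; apply: le_trans.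
  rewrite mulrBl mul1r lerBlDr.
  have := rnormD (z - P z) (P z); rewrite subrK => /le_trans; apply.
  by rewrite lerD2l.
have /cvgrPdist_lt qn : (q ^+ n @[n --> \oo]) --> 0 := cvg_expr q1N.
have scvg : cvgn s.
  apply: cauchy_rnorm => e e0.
  have c0 : 0 < 2 * rnorm y / (1 - q) + 1.
    by rewrite ltr_wpDl // divr_ge0 ?(ltW q1') // mulr_ge0 ?rnorm_ge0.
  have [N _ NP] := qn _ (divr_gt0 e0 c0).
  exists N => m n /andP[Nm mn]; apply: le_lt_trans (sB _ _ mn) _.
  have /= := NP _ Nm; rewrite sub0r normrN ger0_norm ?exprn_ge0 //.
  rewrite ltr_pdivlMr //; apply: le_lt_trans.
  by rewrite ler_wpM2l ?exprn_ge0 // lerDl.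
exists (limn s).
have Pbd : bounded_op P by exists q.
apply: (@cvg_rnorm_unique (fun n => s n - P (s n))).
  by apply: cvgB => //; exact: cvg_bounded_op Pbd scvg.
apply/cvg_rnormP => e e0.
have c0 : 0 < rnorm y + 1 by rewrite ltr_wpDl ?rnorm_ge0.
have := qn _ (divr_gt0 e0 c0); apply: filterS => n.
rewrite sub0r normrN ger0_norm ?exprn_ge0 // sS opprB [y + _]addrC subrK.
rewrite ltr_pdivlMr //; apply: le_lt_trans; apply: le_trans (Pk n) _.
by rewrite ler_wpM2l ?exprn_ge0 // lerDl.
Qed.

End Limits.

(** * Bessel sequences *)

Lemma nneseries_leP {R : realType} (u : nat -> R) (c : R) :
  (forall n, 0 <= u n) ->
  (\sum_(0 <= n <oo) (u n)%:E <= c%:E)%E <->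
  (forall N, \sum_(0 <= n < N) u n <= c).
Proof.
move=> u0; split=> [uc N|uc].
  rewrite -lee_fin; apply: le_trans uc; rewrite -sumEFin.
  by apply: nneseries_lim_ge => n _ _; rewrite lee_fin.
apply: lime_le; first by apply: is_cvg_nneseries => n _ _; rewrite lee_fin.
by apply: nearW => N; rewrite sumEFin lee_fin.
Qed.

Section Bessel.
Context {R : realType} {H : completeNormedModType R[i]}.
Variable dot : {dot H for (@Num.conj R[i])}.
Hypothesis hdot : induces_norm dot.
Implicit Types (x y l : H) (f g u : nat -> H) (c : nat -> R[i]).

Lemma bessel_boundP B f : bessel_bound dot B f <->
  forall x N, \sum_(0 <= n < N) rnorm (dot x (f n)) ^+ 2 <= B * rnorm x ^+ 2.
Proof.
by split=> fB x; apply/nneseries_leP => [n|]; rewrite ?exprn_ge0 ?rnorm_ge0.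
Qed.

Lemma bessel_sum_le B f m n x : bessel_bound dot B f ->
  \sum_(m <= k < n) rnorm (dot x (f k)) ^+ 2 <= B * rnorm x ^+ 2.
Proof.
move=> /bessel_boundP fB; apply: le_trans (fB x n).
have [mn|/ltnW nm] := leqP m n; last first.
  by rewrite big_geq // sumr_ge0 // => k _; rewrite exprn_ge0 // rnorm_ge0.
rewrite [leRHS](big_cat_nat (leq0n m) mn) //= lerDr sumr_ge0 // => k _.
by rewrite exprn_ge0 // rnorm_ge0.
Qed.

(** A Bessel sequence synthesizes square-summable coefficients: this bound is
    dual to the Bessel inequality, with the same constant. *)
Lemma bessel_synth B f c m n : 0 < B -> bessel_bound dot B f ->
  rnorm (\sum_(m <= k < n) c k *: f k) ^+ 2
    <= B * \sum_(m <= k < n) rnorm (c k) ^+ 2.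
Proof.
move=> B0 fB; set v := \sum_(_ <= _ < _) _ *: _.
have vv : rnorm v ^+ 2 <= \sum_(m <= k < n) rnorm (c k) * rnorm (dot v (f k)).
  have -> : rnorm v ^+ 2 = rnorm (dot v v).
    by rewrite (dotxx hdot) rnorm_real ger0_norm // exprn_ge0 // rnorm_ge0.
  rewrite {2}/v dot_sumr; apply: le_trans (rnorm_sum _ _ _) _.
  by apply: ler_sum => k _; rewrite dotZr rnormM rnorm_conj.
(* Each term is at most (B |c_k|^2 + |<v, f_k>|^2 / B) / 2. *)
have {}vv : 2 * rnorm v ^+ 2 <= B * \sum_(m <= k < n) rnorm (c k) ^+ 2
    + B^-1 * \sum_(m <= k < n) rnorm (dot v (f k)) ^+ 2.
  rewrite !mulr_sumr -big_split /=.
  apply: le_trans (_ : 2 * \sum_(m <= k < n) rnorm (c k) * rnorm (dot v (f k)) <= _).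
    by rewrite ler_pM2l.
  rewrite mulr_sumr; apply: ler_sum => k _.
  move: (rnorm (c k)) (rnorm (dot v (f k))) => a b.
  rewrite -subr_ge0.
  have -> : B * a ^+ 2 + B^-1 * b ^+ 2 - 2 * (a * b) = B^-1 * (B * a - b) ^+ 2.
    by field; rewrite gt_eqF.
  by rewrite mulr_ge0 ?sqr_ge0 // invr_ge0 ltW.
have := bessel_sum_le m n v fB.
rewrite -(ler_pM2l (_ : 0 < B^-1)) ?invr_gt0 // mulrA mulVf ?gt_eqF // mul1r.
by move: vv; lra.
Qed.

Lemma synth_bessel B f : 0 <= B ->
  (forall c n, rnorm (\sum_(0 <= k < n) c k *: f k) ^+ 2
    <= B * \sum_(0 <= k < n) rnorm (c k) ^+ 2) ->
  bessel_bound dot B f.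
Proof.
move=> B0 fB; apply/bessel_boundP => x N.
have := fB (fun k => dot x (f k)) N; set v := \sum_(_ <= _ < _) _ *: _.
set s := \sum_(_ <= _ < _) _ => vs.
have s0 : 0 <= s by apply: sumr_ge0 => k _; rewrite exprn_ge0 // rnorm_ge0.
have sE : s = rnorm (dot x v).
  rewrite /v dot_sumr -[LHS]ger0_norm // -rnorm_real rmorph_sum /=.
  by congr rnorm; apply: eq_bigr => k _; rewrite dotZr mulrC mul_conj_rnorm.
have [->|sn0] := eqVneq s 0; first by rewrite mulr_ge0 ?exprn_ge0 ?rnorm_ge0.
have sgt : 0 < s by rewrite lt_neqAle eq_sym sn0.
have : s ^+ 2 <= rnorm x ^+ 2 * (B * s).
  apply: le_trans (_ : (rnorm x * rnorm v) ^+ 2 <= _).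
    by rewrite ler_pXn2r ?nnegrE ?mulr_ge0 ?rnorm_ge0 // {1}sE CauchySchwarz.
  by rewrite exprMn ler_wpM2l // exprn_ge0 // rnorm_ge0.
by rewrite expr2 mulrA ler_pM2r // mulrC.
Qed.

Lemma bessel_series_cvg f c (M : R) : bessel dot f ->
  (forall N, \sum_(0 <= k < N) rnorm (c k) ^+ 2 <= M) ->
  cvgn (series (fun k => c k *: f k)).
Proof.
move=> [B [B0 fB]] cM; pose s := series (fun k => rnorm (c k) ^+ 2).
have s_nd : nondecreasing_seq s.
  by apply: nondecreasing_series => k _; rewrite exprn_ge0 // rnorm_ge0.
have scvg : cvgn s.
  by apply: nondecreasing_is_cvgn => //; exists M => _ [N _ <-]; exact: cM.
apply: cauchy_rnorm => e e0.
have e0' : 0 < e ^+ 2 / B / 2 by rewrite !divr_gt0 ?exprn_gt0.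
have /cvgrPdist_lt/(_ _ e0') [N _ NP] := scvg.
exists N => m n /andP[Nm mn].
rewrite sub_series_geq // -(@ltr_pXn2r _ 2) ?nnegrE ?rnorm_ge0 ?ltW //.
apply: le_lt_trans (bessel_synth _ _ _ B0 fB) _.
rewrite -ltr_pdivlMl // -[X in X < _](sub_series_geq _ mn).
have /= := NP m Nm; have /= := NP n (leq_trans Nm mn).
rewrite -/(s n) -/(s m) !ltr_norml mulrC => /andP[h1 h2] /andP[h3 h4].
lra.
Qed.

Lemma cvg_dotl (s : nat -> H) l y : s @ \oo --> l ->
  (fun n => dot (s n) y : R[i]^o) @ \oo --> (dot l y : R[i]^o).
Proof.
move=> /cvg_rnormP sl; apply/cvg_rnormP => e e0.
have y0 : 0 < rnorm y + 1 by rewrite ltr_wpDl ?rnorm_ge0.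
have := sl _ (divr_gt0 e0 y0); apply: filterS => n.
rewrite ltr_pdivlMr // -linearBl; apply: le_lt_trans.
apply: le_trans (CauchySchwarz hdot _ _) _.
by rewrite ler_wpM2l ?rnorm_ge0 // lerDl.
Qed.

Lemma cvg_dotr (s : nat -> H) l y : s @ \oo --> l ->
  (fun n => dot y (s n) : R[i]^o) @ \oo --> (dot y l : R[i]^o).
Proof.
move=> /(@cvg_dotl _ _ y)/cvg_rnormP sl; apply/cvg_rnormP => e /sl.
by apply: filterS => n; rewrite ![dot y _]dotC -rmorphB rnorm_conj.
Qed.

Lemma bounded_op_sqr B (T : H -> H) :
  (forall x, rnorm (T x) ^+ 2 <= B * rnorm x ^+ 2) ->
  forall x, rnorm (T x) <= Num.sqrt B * rnorm x.
Proof.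
move=> TB x; have [B0|/ltW B0] := leP 0 B.
  rewrite -(@ler_pXn2r _ 2) ?nnegrE ?mulr_ge0 ?rnorm_ge0 ?sqrtr_ge0 //.
  by rewrite exprMn sqr_sqrtr.
rewrite -(@ler_pXn2r _ 2) ?nnegrE ?mulr_ge0 ?rnorm_ge0 ?sqrtr_ge0 //.
apply: le_trans (TB x) _; apply: le_trans (_ : 0 <= _).
  by rewrite mulr_le0_ge0 // exprn_ge0 // rnorm_ge0.
by rewrite exprn_ge0 // mulr_ge0 ?rnorm_ge0 ?sqrtr_ge0.
Qed.

(** The mixed frame operator of two Bessel sequences: analysis by [f] followed
    by synthesis by [g].  Adjoints and frame operators are
    of this form. *)
Lemma mixed_op Bf Bg f g : 0 < Bf -> 0 < Bg ->
  bessel_bound dot Bf f -> bessel_bound dot Bg g ->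
  exists T : {linear H -> H},
    (forall x, rnorm (T x) ^+ 2 <= Bf * Bg * rnorm x ^+ 2) /\
    forall x, series (fun k => dot x (f k) *: g k) @ \oo --> T x.
Proof.
move=> Bf0 Bg0 fB gB.
have scvg x : cvgn (series (fun k => dot x (f k) *: g k)).
  apply: (@bessel_series_cvg _ _ (Bf * rnorm x ^+ 2)); first by exists Bg.
  by move=> N; exact: bessel_sum_le fB.
have [|T TE] := @linear_ext _ _ (fun x => limn (series (fun k => dot x (f k) *: g k))).
  move=> a x y; apply: (cvg_rnorm_unique (scvg _)).
  have -> : series (fun k => dot (a *: x + y) (f k) *: g k) =
      a *: series (fun k => dot x (f k) *: g k) +
      series (fun k => dot y (f k) *: g k).
    apply/funext => n; rewrite /= !fctE /series /= scaler_sumr -big_split /=.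
    by apply: eq_bigr => k _; rewrite linearPl /= scalerDl scalerA.
  by apply: cvgD; [apply: cvgZr|]; exact: scvg.
exists T; split=> x; last by rewrite TE; exact: scvg.
have h : rnorm (T x) <= Num.sqrt (Bf * Bg * rnorm x ^+ 2).
  apply: rnorm_lim_le (_ : _ --> T x) _; first by rewrite TE; exact: scvg.
  move=> n; rewrite -(@ler_pXn2r _ 2) ?nnegrE ?rnorm_ge0 ?sqrtr_ge0 //.
  rewrite sqr_sqrtr ?mulr_ge0 ?exprn_ge0 ?rnorm_ge0 ?(ltW Bf0) ?(ltW Bg0) //.
  rewrite /series /=.
  apply: le_trans (bessel_synth _ _ _ Bg0 gB) _.
  by rewrite -mulrA mulrCA ler_pM2l // bessel_sum_le.
rewrite -[leRHS]sqr_sqrtr ?mulr_ge0 ?exprn_ge0 ?rnorm_ge0 ?(ltW Bf0) ?(ltW Bg0) //.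
by rewrite ler_pXn2r // nnegrE ?rnorm_ge0 ?sqrtr_ge0.
Qed.

Lemma mixed_op_adjoint f g (T S : H -> H) :
  (forall x, series (fun k => dot x (f k) *: g k) @ \oo --> T x) ->
  (forall x, series (fun k => dot x (g k) *: f k) @ \oo --> S x) ->
  forall x y, dot (T x) y = dot x (S y).
Proof.
move=> fg gf x y; have h1 := cvg_dotl (y := y) (fg x); have h2 := cvg_dotr (y := x) (gf y).
rewrite (_ : (fun n => _) = (fun n =>
    dot (series (fun k => dot x (f k) *: g k) n) y)) in h2.
  exact: cvg_unique h1 h2.
apply/funext => n; rewrite /series /= dot_suml dot_sumr.
by apply: eq_bigr => k _; rewrite dotZl dotZr -dotC mulrC.
Qed.

Lemma bessel_image (T : {linear H -> H}) f :
  bounded_op T -> bessel dot f -> bessel dot (T \o f).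
Proof.
move=> /bounded_op_ge0[M M0 TM] [B [B0 fB]].
exists (M ^+ 2 * B + 1); split; first by rewrite ltr_wpDl // mulr_ge0 ?exprn_ge0 // ltW.
apply: synth_bessel => [|c n].
  by rewrite addr_ge0 // mulr_ge0 ?exprn_ge0 // ltW.
have -> : \sum_(0 <= k < n) c k *: (T \o f) k = T (\sum_(0 <= k < n) c k *: f k).
  by rewrite linear_sum; apply: eq_bigr => k _; rewrite linearZ.
set v := \sum_(_ <= _ < _) _ *: _.
apply: le_trans (_ : (M * rnorm v) ^+ 2 <= _).
  by rewrite ler_pXn2r // nnegrE ?mulr_ge0 ?rnorm_ge0.
rewrite exprMn mulrDl mul1r.
apply: le_trans (_ : M ^+ 2 * (B * \sum_(0 <= k < n) rnorm (c k) ^+ 2) <= _).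
  by rewrite ler_wpM2l ?exprn_ge0 // bessel_synth.
by rewrite mulrA lerDl sumr_ge0 // => k _; rewrite exprn_ge0 // rnorm_ge0.
Qed.

End Bessel.

(** * Orthonormal and Riesz bases *)

Section Orthonormal.
Context {R : realType} {H : completeNormedModType R[i]}.
Variable dot : {dot H for (@Num.conj R[i])}.
Hypothesis hdot : induces_norm dot.
Implicit Types (x y l : H) (f g u e : nat -> H) (c : nat -> R[i]).

Lemma dot_synth u v c n m : (forall i j : nat, dot (u i) (v j) = (i == j)%:R) ->
  dot (\sum_(0 <= k < n) c k *: u k) (v m) = if (m < n)%N then c m else 0.
Proof.
move=> uv; elim: n => [|n IH]; first by rewrite big_geq // linear0l.
rewrite big_nat_recr //= linearDl /= IH dotZl uv ltnS.
have [->|nm] := eqVneq n m; first by rewrite ltnn leqnn mulr1 add0r.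
by rewrite mulr0 addr0 [in RHS]leq_eqVlt [m == n]eq_sym (negbTE nm).
Qed.

Lemma orthonormal_synth u c n : (forall i j : nat, dot (u i) (u j) = (i == j)%:R) ->
  rnorm (\sum_(0 <= k < n) c k *: u k) ^+ 2 = \sum_(0 <= k < n) rnorm (c k) ^+ 2.
Proof.
move=> uo; elim: n => [|n IH].
  by rewrite !big_geq // rnorm0 expr0n.
rewrite !big_nat_recr //= (rnorm_sqrD hdot) IH dotZr dot_synth // ltnn mulr0 mulr0 addr0.
have u1 : rnorm (u n) ^+ 2 = 1.
  by apply: complexI; rewrite -(dotxx hdot) uo eqxx.
by rewrite rnormZ exprMn u1 mulr1.
Qed.

Lemma orthonormal_bessel u : (forall i j : nat, dot (u i) (u j) = (i == j)%:R) ->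
  bessel_bound dot 1 u.
Proof.
by move=> uo; apply: synth_bessel => // c n; rewrite orthonormal_synth // mul1r.
Qed.

Lemma orthonormal_basis_expansion u x : orthonormal_basis dot u ->
  series (fun k => dot x (u k) *: u k) @ \oo --> x.
Proof.
move=> [uo ud]; have uB := orthonormal_bessel uo.
(* The frame operator of [u] is the identity on the span of [u], which is
   dense. *)
have [T [TB Tx]] := mixed_op hdot ltr01 ltr01 uB uB.
have {}TB y : rnorm (T y) <= rnorm y.
  by have := bounded_op_sqr TB y; rewrite mulr1 sqrtr1 mul1r.
have Tu m : T (u m) = u m.
  apply: (cvg_rnorm_unique (Tx _)); apply/cvg_rnormP => e e0.
  exists m.+1 => // n /= mn; suff -> : series (fun k => dot (u m) (u k) *: u k) n = u m.
    by rewrite subrr rnorm0.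
  rewrite /series /= (bigD1_seq m) ?iota_uniq ?mem_index_iota //= uo eqxx scale1r.
  by rewrite big1_seq ?addr0 // => k /andP[km _]; rewrite uo eq_sym (negbTE km) scale0r.
have Tspan a : lin_span (range u) a -> T a = a.
  move=> [n [b [v [vu ->]]]]; rewrite linear_sum; apply: eq_bigr => i _.
  by rewrite linearZ /=; have [k _ <-] := vu i; rewrite Tu.
suff TE : T x = x by have := Tx x; rewrite TE.
apply/esym/eqP; rewrite -subr_eq0; apply/eqP/rnorm0_eq0/eqP.
rewrite eq_le rnorm_ge0 andbT; apply/ler_addgt0Pl => e e0; rewrite addr0.
have /denseP/(_ x (e / 2)) [|a ua xa] := ud; first by rewrite divr_gt0.
have -> : x - T x = (x - a) - T (x - a).
  by rewrite linearB /= (Tspan _ ua) opprB addrA subrK.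
by apply: le_trans (rnormB _ _) _; have := TB (x - a); lra.
Qed.

(** The Gram-Schmidt step.  When [d] already lies in the span of [s], infinite
    dimension still provides a new direction. *)
Lemma gram_schmidt_step (s : seq H) (d : H) : infinite_dimensional H ->
  (forall i j : nat, (i < size s)%N -> (j < size s)%N ->
     dot s`_i s`_j = (i == j)%:R) ->
  exists v, [/\ dot v v = 1,
    forall i, (i < size s)%N -> dot v s`_i = 0 &
    exists (a : nat -> R[i]) b, d = \sum_(i < size s) a i *: s`_i + b *: v].
Proof.
move=> hinf so; pose P x := \sum_(i < size s) dot x s`_i *: s`_i.
have Po x j : (j < size s)%N -> dot (x - P x) s`_j = 0.
  move=> js; rewrite linearBl /= /P dot_suml (bigD1 (Ordinal js)) //= dotZl so //.
  rewrite eqxx mulr1 big1 ?addr0 ?subrr // => i ij.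
  by rewrite dotZl so // -[val i == j]/(i == Ordinal js) (negbTE ij) mulr0.
have nz x : x != P x -> rnorm (x - P x) != 0.
  by apply: contra_neq => /rnorm0_eq0/eqP; rewrite subr_eq0 => /eqP.
pose v x := ((rnorm (x - P x))^-1)%:C%C *: (x - P x).
have vo x j : (j < size s)%N -> dot (v x) s`_j = 0.
  by move=> js; rewrite dotZl Po // mulr0.
have vv x : x != P x -> dot (v x) (v x) = 1.
  move=> /nz xn; rewrite (dotxx hdot) rnormZ rnorm_real ger0_norm ?invr_ge0 ?rnorm_ge0 //.
  by rewrite mulVf // expr1n.
have [dP|dP] := eqVneq d (P d); last first.
  exists (v d); split; [exact: vv|exact: vo|].
  exists (fun i => dot d s`_i), (rnorm (d - P d))%:C%C.
  by rewrite -/(P d) scalerA -rmorphM mulfV ?nz // scale1r addrC subrK.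
have [x xP] : exists x, x != P x.
  apply: contrapT => /forallNP nP; apply: (hinf _ (finite_seq s)).
  apply/seteqP; split=> // x _.
  exists (size s), (fun i => dot x s`_i), (fun i => s`_i); split.
    by move=> i /=; rewrite mem_nth.
  by have /negP := nP x; rewrite negbK => /eqP.
exists (v x); split; [exact: vv|exact: vo|].
by exists (fun i => dot d s`_i), 0; rewrite scale0r addr0.
Qed.

(** The n-th step of the orthonormalization puts the n-th vector of a dense
    sequence into the span of the vectors chosen so far. *)
Lemma orthonormal_basis_exists : separable H -> infinite_dimensional H ->
  exists u, orthonormal_basis dot u.
Proof.
move=> [A [/countable_injP[g ginj] dA]] hinf.
have [d dP] : exists d : nat -> H, forall x, A x -> d (g x) = x.
  have /choice[d dP] : forall n, exists y, forall x, A x -> g x = n -> y = x.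
    move=> n; have [[y Ay yn]|nex] := pselect (exists2 y, A y & g y = n).
      exists y => x Ax xn; apply: ginj; rewrite ?inE //; congruence.
    by exists 0 => x Ax xn; exfalso; apply: nex; exists x.
  by exists d => x Ax; apply: dP Ax _.
pose ons (s : seq H) := forall i j : nat, (i < size s)%N -> (j < size s)%N ->
     dot s`_i s`_j = (i == j)%:R.
have /choice[G GP] : forall p : seq H * H, exists v, ons p.1 -> [/\ dot v v = 1,
    forall i, (i < size p.1)%N -> dot v p.1`_i = 0 &
    exists (a : nat -> R[i]) b, p.2 = \sum_(i < size p.1) a i *: p.1`_i + b *: v].
  move=> [s x]; have [so|nso] := pselect (ons s); last by exists 0.
  by have [v vP] := gram_schmidt_step x hinf so; exists v.
pose U := fix U n := if n is m.+1 then rcons (U m) (G (U m, d m)) else [::].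
pose u n := G (U n, d n).
have UE n : U n = mkseq u n.
  by elim: n => // n IH; rewrite /mkseq -[in RHS]addn1 iotaD map_cat /= cats1 -/(mkseq u n) -IH.
have Uo n : ons (U n).
  elim: n => [|n IH] //.
  have sz : size (U n) = n by rewrite UE size_mkseq.
  have [v1 vo _] := GP (U n, d n) IH.
  have {}v1 : dot (u n) (u n) = 1 by exact: v1.
  have {}vo i : (i < n)%N -> dot (u n) (U n)`_i = 0.
    by move=> i_n; apply: vo; rewrite sz.
  have US : U n.+1 = rcons (U n) (u n) by [].
  move=> i j; rewrite US size_rcons sz !ltnS !nth_rcons sz.
  rewrite [(i <= n)%N]leq_eqVlt [(j <= n)%N]leq_eqVlt => /predU1P[->|i_n] /predU1P[->|j_n].
  - by rewrite ltnn !eqxx.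
  - by rewrite ltnn eqxx j_n vo // gtn_eqF.
  - by rewrite ltnn eqxx i_n dotC vo // conjC0 ltn_eqF.
  - by rewrite i_n j_n IH // sz.
exists u; split=> [i j|].
  have := Uo (maxn i j).+1 i j; rewrite UE size_mkseq !ltnS leq_maxl leq_maxr.
  by rewrite !nth_mkseq ?ltnS ?leq_maxl ?leq_maxr // => ->.
apply/denseP => x e e0; have /denseP/(_ x e e0) [a Aa xa] := dA.
exists a => //; have [_ _ [c [b]]] := GP (U (g a), d (g a)) (Uo _).
rewrite /= (dP a Aa) -/(u (g a)) UE size_mkseq => aE.
exists (g a).+1, (fun i => if (i < g a)%N then c i else b), (u \o val).
split=> [i|]; first by exists i.
rewrite big_ord_recr /= ltnn [LHS]aE; congr (_ + _).
  by apply: eq_bigr => i _; rewrite nth_mkseq // ltn_ord.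
by rewrite -UE /u (dP a Aa).
Qed.

Lemma orthonormal_basis_riesz u : orthonormal_basis dot u -> riesz_basis dot u.
Proof.
move=> uo; exists u, idfun, idfun.
by split=> //; exists 1 => x; rewrite mul1r.
Qed.

(** The adjoint of a bounded operator, synthesized from an orthonormal basis. *)
Lemma adjoint_exists u (T : {linear H -> H}) :
  orthonormal_basis dot u -> bounded_op T ->
  exists S : {linear H -> H}, bounded_op S /\
    forall x y, dot (T x) y = dot x (S y).
Proof.
move=> ub Tb; have uB := orthonormal_bessel ub.1.
have [B [B0 TuB]] : bessel dot (T \o u).
  by apply: bessel_image => //; exists 1; split.
have [S [SB Sx]] := mixed_op hdot B0 ltr01 TuB uB.
exists S; split; first by eexists; exact: bounded_op_sqr SB.
apply: (mixed_op_adjoint hdot) Sx => x.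
have /(cvg_bounded_op Tb) := @orthonormal_basis_expansion u x ub.
rewrite (_ : T \o _ = series (fun k => dot x (u k) *: (T \o u) k)) //.
apply/funext => n; rewrite /series /= linear_sum.
by apply: eq_bigr => k _; rewrite linearZ.
Qed.

(** A Riesz basis has a biorthogonal Riesz basis, in which every vector expands
    with the coefficients read off by the original basis. *)
Lemma riesz_basis_dual e : riesz_basis dot e ->
  exists r, [/\ riesz_basis dot r, bessel dot e, bessel dot r,
    forall m n : nat, dot (e m) (r n) = (m == n)%:R &
    forall x, series (fun k => dot x (e k) *: r k) @ \oo --> x].
Proof.
move=> [u [T [S [ub Tb Sb [TK SK] eE]]]].
have [T' [T'b TT']] := adjoint_exists ub Tb.
have [S' [S'b SS']] := adjoint_exists ub Sb.
have uB : bessel dot u by exists 1; split=> //; exact: orthonormal_bessel ub.1.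
have dotI x y : (forall z, dot z x = dot z y) -> x = y.
  by move=> xy; apply: (@dot_inj _ _ dot) => z; rewrite dotC xy -dotC.
have S'T' x : S' (T' x) = x.
  by apply: dotI => z; rewrite -SS' -TT' SK.
have T'S' x : T' (S' x) = x.
  by apply: dotI => z; rewrite -TT' -SS' TK.
exists (S' \o u); split.
- by exists u, S', T'; split.
- by have -> : e = T \o u by [apply/funext]; exact: bessel_image.
- exact: bessel_image.
- by move=> m n; rewrite eE /= -SS' TK ub.1.
- move=> x; have /(cvg_bounded_op S'b) := @orthonormal_basis_expansion u (T' x) ub.
  rewrite S'T' (_ : S' \o _ = series (fun k => dot x (e k) *: (S' \o u) k)) //.
  apply/funext => n; rewrite /series /= linear_sum; apply: eq_bigr => k _.
  by rewrite linearZ /= eE [dot x _]dotC TT' -dotC.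
Qed.

End Orthonormal.

(** * Sums of absolute coefficients *)

Section L1.
Context {R : realType} {H : completeNormedModType R[i]}.
Variable dot : {dot H for (@Num.conj R[i])}.
Hypothesis hdot : induces_norm dot.
Implicit Types (x y l : H) (f g u e r : nat -> H) (c : nat -> R[i]) (M : set H).

Lemma l1norm_leP e x (C : R) : (l1norm dot e x <= C%:E)%E <->
  forall N, \sum_(0 <= k < N) rnorm (dot x (e k)) <= C.
Proof. by apply: nneseries_leP => n; exact: rnorm_ge0. Qed.

Lemma l1norm_ge0 e x : (0 <= l1norm dot e x)%E.
Proof. by apply: nneseries_ge0 => n _ _; rewrite lee_fin rnorm_ge0. Qed.

Lemma l1norm_sup_finP e M : (ereal_sup (l1norm dot e @` M) < +oo)%E <->
  exists C : R, forall x, M x ->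
    forall N, \sum_(0 <= k < N) rnorm (dot x (e k)) <= C.
Proof.
set b := ereal_sup _; split=> [bfin|[C MC]].
  exists (fine b) => x Mx; apply/l1norm_leP.
  have xb : (l1norm dot e x <= b)%E by apply: ereal_sup_ubound; exists x.
  rewrite fineK // ge0_fin_numE //; exact: le_trans (l1norm_ge0 e x) xb.
apply: (@le_lt_trans _ _ C%:E); last exact: ltry.
by apply: ge_ereal_sup => _ [x Mx <-]; apply/l1norm_leP; exact: MC.
Qed.

Lemma l1spaceP e x : l1space dot e x <->
  exists C : R, forall N, \sum_(0 <= k < N) rnorm (dot x (e k)) <= C.
Proof.
split=> [xfin|[C xC]].
  exists (fine (l1norm dot e x)); apply/l1norm_leP.
  by rewrite fineK // ge0_fin_numE // l1norm_ge0.
by apply: (@le_lt_trans _ _ C%:E); [exact/l1norm_leP|exact: ltry].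
Qed.

(** A series with absolutely summable coefficients inherits the common l1 bound
    of its vectors [g k]. *)
Lemma l1_series_le g r c x (A C : R) :
  series (fun k => c k *: g k) @ \oo --> x ->
  (forall N, \sum_(0 <= k < N) rnorm (c k) <= A) ->
  (forall k N, \sum_(0 <= j < N) rnorm (dot (g k) (r j)) <= C) ->
  forall N, \sum_(0 <= j < N) rnorm (dot x (r j)) <= A * C.
Proof.
move=> cx cA gC N.
have C0 : 0 <= C by have := gC 0 0; rewrite big_geq.
pose s n := \sum_(0 <= j < N)
  rnorm (dot (series (fun k => c k *: g k) n) (r j)).
have sx : s @ \oo --> \sum_(0 <= j < N) rnorm (dot x (r j)).
  rewrite /s; elim: N {s} => [|N IH].
    under eq_fun do rewrite big_geq //.
    by rewrite big_geq //; exact: cvg_cst.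
  under eq_fun do rewrite big_nat_recr //=.
  rewrite big_nat_recr //=; apply: cvgD => //.
  exact: (cvg_rnorm (cvg_dotl hdot (y := r N) cx)).
rewrite -(cvg_lim (@Rhausdorff R) sx); apply: limr_le; first exact: cvgP sx.
apply: nearW => n; rewrite /s.
apply: le_trans (_ : \sum_(0 <= j < N) \sum_(0 <= k < n)
    rnorm (c k) * rnorm (dot (g k) (r j)) <= _).
  apply: ler_sum => j _; rewrite /series /= dot_suml.
  apply: le_trans (rnorm_sum _ _ _) _.
  by apply: ler_sum => k _; rewrite dotZl rnormM.
rewrite exchange_big /=.
apply: le_trans (_ : \sum_(0 <= k < n) rnorm (c k) * C <= _).
  by apply: ler_sum => k _; rewrite -mulr_sumr ler_wpM2l // rnorm_ge0.
by rewrite -mulr_suml ler_wpM2r.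
Qed.

Lemma riesz_basis_l1_bounded e : riesz_basis dot e -> l1_bounded dot (range e).
Proof.
move=> /(riesz_basis_dual hdot)[r [rb _ _ er _]].
exists r; split => //; apply/l1norm_sup_finP; exists 1 => _ [m _ <-] N.
under eq_bigr do rewrite er.
have -> : \sum_(0 <= k < N) rnorm ((m == k)%:R : R[i]) = (m < N)%:R.
  elim: N => [|N IH]; first by rewrite big_geq.
  rewrite big_nat_recr //= IH ltnS; have [->|mN] := eqVneq m N.
    by rewrite ltnn leqnn add0r -[1]/(1%:C%C) rnorm_real normr1.
  by rewrite rnorm0 addr0 [in RHS]leq_eqVlt (negbTE mN).
by case: (m < N)%N.
Qed.

Lemma riesz_basis_frame e : riesz_basis dot e -> frame dot e.
Proof.
move=> /(riesz_basis_dual hdot)[r [_ [B [B0 eB]] [Br [Br0 rB]] _ xE]].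
exists (Num.min Br^-1 B), B; split=> //.
- by rewrite lt_min invr_gt0 Br0.
- by rewrite ge_min lexx orbT.
move=> x; have := eB x; set b := (\sum_(_ <= _ <oo) _)%E => bB.
have b0 : (0 <= b)%E.
  by apply: nneseries_ge0 => n _ _; rewrite lee_fin exprn_ge0 // rnorm_ge0.
have bfin : b \is a fin_num.
  by rewrite ge0_fin_numE //; apply: le_lt_trans bB (ltry _).
have bN N : \sum_(0 <= k < N) rnorm (dot x (e k)) ^+ 2 <= fine b.
  by move: N; apply/nneseries_leP => [k|]; rewrite ?exprn_ge0 ?rnorm_ge0 // fineK.
have fb0 : 0 <= fine b by rewrite fine_ge0.
have xb : rnorm x <= Num.sqrt (Br * fine b).
  apply: rnorm_lim_le (xE x) _ => n.
  rewrite -(@ler_pXn2r _ 2) ?nnegrE ?rnorm_ge0 ?sqrtr_ge0 //.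
  rewrite sqr_sqrtr ?mulr_ge0 ?(ltW Br0) //.
  rewrite /series /=; apply: le_trans (bessel_synth hdot _ _ _ Br0 rB) _.
  by rewrite ler_pM2l.
rewrite -[b]fineK // lee_fin.
apply: le_trans (_ : Br^-1 * rnorm x ^+ 2 <= _).
  by rewrite ler_wpM2r ?exprn_ge0 ?rnorm_ge0 // ge_min lexx.
rewrite ler_pdivrMl // -[leRHS]sqr_sqrtr ?mulr_ge0 ?(ltW Br0) //.
by rewrite ler_pXn2r // nnegrE ?rnorm_ge0 ?sqrtr_ge0.
Qed.

(** The canonical dual frame: the frame operator is inverted as in the
    Lax-Milgram theorem, by contracting [x - t S x] for a small [t]. *)
Lemma frame_dual f : frame dot f -> exists g, bessel dot g /\
  forall x, series (fun k => dot x (f k) *: g k) @ \oo --> x.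
Proof.
move=> [A [B [A0 AB fB fA]]]; have B0 : 0 < B := lt_le_trans A0 AB.
have [S [SB Sx]] := mixed_op hdot B0 B0 fB fB.
have SA x : A * rnorm x ^+ 2 <= complex.Re (dot (S x) x).
  rewrite -lee_fin; apply: le_trans (fA x) _; apply/nneseries_leP.
    by move=> n; rewrite exprn_ge0 // rnorm_ge0.
  pose s n := \sum_(0 <= k < n) rnorm (dot x (f k)) ^+ 2.
  have sl : s @ \oo --> complex.Re (dot (S x) x).
    apply/cvgrPdist_lt => d d0.
    have /cvg_rnormP/(_ d d0) := cvg_dotl hdot (y := x) (Sx x).
    apply: filterS => n; apply: le_lt_trans.
    rewrite (_ : dot (series _ n) x = (s n)%:C%C).
      by apply: le_trans (Re_le_rnorm _); case: (dot (S x) x).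
    rewrite /series /= dot_suml /s rmorph_sum; apply: eq_bigr => k _.
    by rewrite dotZl [dot (f k) x]dotC mul_conj_rnorm.
  move=> N; rewrite -[X in _ <= X](cvg_lim (@Rhausdorff R) sl).
  apply: nondecreasing_cvgn_le; last exact: cvgP sl.
  by apply: nondecreasing_series => k _; rewrite exprn_ge0 // rnorm_ge0.
have SA' x : A * rnorm x <= rnorm (S x).
  have [->|x0] := eqVneq x 0; first by rewrite rnorm0 mulr0 rnorm_ge0.
  have nx : 0 < rnorm x.
    by rewrite lt_neqAle rnorm_ge0 andbT eq_sym; apply: contra_neq x0; exact: rnorm0_eq0.
  rewrite -(ler_pM2r nx) -mulrA -expr2; apply: le_trans (SA x) _.
  apply: le_trans (ler_norm _) _; apply: le_trans (Re_le_rnorm _) _.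
  exact: CauchySchwarz.
(* This t minimizes the bound 1 - 2 t A + t^2 B^2 on the squared norm
   of 1 - t S. *)
pose t := A / B ^+ 2; have t0 : 0 < t by rewrite divr_gt0 // exprn_gt0.
have [|P PE] := @linear_ext _ _ (fun x => x - t%:C%C *: S x).
  move=> a x y; rewrite linearP scalerDr opprD addrACA scalerBr.
  by rewrite !scalerA [t%:C%C * _]mulrC.
pose q := 1 - A ^+ 2 / B ^+ 2.
have q0 : 0 <= q.
  by rewrite subr_ge0 ler_pdivrMr ?exprn_gt0 // mul1r ler_pXn2r // nnegrE ltW.
have q1 : q < 1 by rewrite ltrBlDr ltrDl divr_gt0 // exprn_gt0.
have PB x : rnorm (P x) ^+ 2 <= q * rnorm x ^+ 2.
  rewrite PE (rnorm_sqrD hdot) rnormN rnormZ rnorm_real gtr0_norm // linearNr /= dotZr.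
  rewrite conj_realC exprMn.
  have -> : complex.Re (- (t%:C%C * dot x (S x))) = - (t * complex.Re (dot (S x) x)).
    rewrite dotC; case: (dot (S x) x) => a b /=; rewrite mul0r.
    by rewrite subr0.
  have h1 : t ^+ 2 * rnorm (S x) ^+ 2 <= t ^+ 2 * (B * B * rnorm x ^+ 2).
    by rewrite ler_wpM2l // exprn_ge0 // ltW.
  have h2 : t * (A * rnorm x ^+ 2) <= t * complex.Re (dot (S x) x).
    by rewrite ler_wpM2l // ltW.
  have h3 : t ^+ 2 * (B * B * rnorm x ^+ 2) = A ^+ 2 / B ^+ 2 * rnorm x ^+ 2.
    by rewrite /t; field; rewrite gt_eqF.
  have h4 : t * (A * rnorm x ^+ 2) = A ^+ 2 / B ^+ 2 * rnorm x ^+ 2.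
    by rewrite /t; field; rewrite gt_eqF.
  by rewrite /q mulrBl; lra.
have sq1 : Num.sqrt q < 1 by rewrite -sqrtr1 ltr_sqrt.
have Ssurj y : exists x, S x = y.
  have [x xE] := neumann (sqrtr_ge0 q) sq1 (bounded_op_sqr PB) (t%:C%C *: y).
  exists x; move: xE; rewrite PE subKr => /scalerI; apply.
  by apply/eqP => /complexI /eqP; rewrite gt_eqF.
have [G [Gb SK GK]] := bounded_inverse A0 SA' Ssurj.
exists (G \o f); split; first by apply: bessel_image => //; exists B.
move=> x; have /(cvg_bounded_op Gb) := Sx x.
rewrite SK (_ : G \o _ = series (fun k => dot x (f k) *: (G \o f) k)) //.
by apply/funext => n; rewrite /series /= linear_sum; apply: eq_bigr => k _; rewrite linearZ.
Qed.

(** The bounded operator [T] that sends the orthonormal basis [u] to the Bessel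
    sequence [f] is the sum of two invertible operators: [k] times the identity,
    for [k] larger than the norm of [T], and the difference. *)
Lemma bessel_riesz_decomposition u f : orthonormal_basis dot u ->
  bessel dot f -> exists (k : R) e, riesz_basis dot e /\
    forall n, f n = e n + k%:C%C *: u n.
Proof.
move=> ub [B [B0 fB]]; have uB := orthonormal_bessel hdot ub.1.
have [T [TB Tx]] := mixed_op hdot ltr01 B0 uB fB.
rewrite mul1r in TB; have {}TB := bounded_op_sqr TB.
have Tu n : T (u n) = f n.
  apply: (cvg_rnorm_unique (Tx _)); apply/cvg_rnormP => d d0.
  exists n.+1 => // m /= nm; rewrite /series /=.
  rewrite (bigD1_seq n) ?iota_uniq ?mem_index_iota //= ub.1 eqxx scale1r.
  rewrite big1_seq ?addr0 ?subrr ?rnorm0 // => i /andP[ni _].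
  by rewrite ub.1 eq_sym (negbTE ni) scale0r.
pose k := 1 + B; have k0 : 0 < k by rewrite addr_gt0.
(* The norm of T is at most sqrt B, which is less than 1 + B. *)
have sk : Num.sqrt B < k.
  rewrite -(@ltr_pXn2r _ 2) ?nnegrE ?sqrtr_ge0 ?(ltW k0) // sqr_sqrtr ?(ltW B0) //.
  by rewrite /k; nra.
have kC : k%:C%C != 0 by apply/eqP => /complexI /eqP; rewrite gt_eqF.
have [|W WE] := @linear_ext _ _ (fun y => T y - k%:C%C *: y).
  move=> a x y; rewrite linearP scalerDr opprD addrACA scalerBr.
  by rewrite !scalerA [k%:C%C * _]mulrC.
have [|P PE] := @linear_ext _ _ (fun y => k^-1%:C%C *: T y).
  by move=> a x y; rewrite linearP scalerDr !scalerA [k^-1%:C%C * _]mulrC.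
have WP y : W y = - (k%:C%C *: (y - P y)).
  rewrite WE PE scalerBr scalerA -rmorphM mulfV ?gt_eqF // scale1r.
  by rewrite opprB.
have Wc y : (k - Num.sqrt B) * rnorm y <= rnorm (W y).
  have := TB y; have := rnormB (T y) (W y).
  rewrite {1}WE opprB addrCA subrr addr0 rnormZ rnorm_real gtr0_norm //.
  by rewrite mulrBl; lra.
have Wsurj z : exists y, W y = z.
  have Pq x : rnorm (P x) <= Num.sqrt B / k * rnorm x.
    rewrite PE rnormZ rnorm_real gtr0_norm ?invr_gt0 // mulrC mulrAC.
    by rewrite ler_pM2r ?invr_gt0.
  have [||y yE] := neumann _ _ Pq (- (k^-1%:C%C *: z)).
  - by rewrite divr_ge0 ?sqrtr_ge0 ?(ltW k0).
  - by rewrite ltr_pdivrMr // mul1r.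
  exists y; rewrite WP yE scalerN opprK scalerA -rmorphM mulfV ?gt_eqF //.
  by rewrite scale1r.
have c0 : 0 < k - Num.sqrt B by rewrite subr_gt0.
have [S [Sb SK WK]] := bounded_inverse c0 Wc Wsurj.
exists k, (W \o u); split; last by move=> n; rewrite /= WE Tu subrK.
exists u, W, S; split=> //; exists (Num.sqrt B + k) => y.
rewrite WE; apply: le_trans (rnormB _ _) _.
by rewrite rnormZ rnorm_real gtr0_norm // [leRHS]mulrDl lerD2r.
Qed.

End L1.

(** * Unconditional summability *)

(** Intervals [[a i, a i.+1[] tile the natural numbers when [a] increases
    strictly from 0, so permuting each of them separately is a bijection. *)
Lemma block_permutation (a : nat -> nat) (L : nat -> seq nat) :
  a 0%N = 0%N -> (forall i, (a i < a i.+1)%N) ->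
  (forall i, perm_eq (L i) (index_iota (a i) (a i.+1))) ->
  exists s : nat -> nat, bijective s /\
    forall i j, (j < size (L i))%N -> s (a i + j) = nth 0%N (L i) j.
Proof.
move=> a0 ai aL.
have amono : {homo a : i j / (i <= j)%N}.
  by apply: homo_leq => // [? ? ?|i]; [exact: leq_trans|exact: ltnW].
have /choice[b bP] : forall n, exists i, (a i <= n < a i.+1)%N.
  elim=> [|n [i /andP[ain nai]]]; first by exists 0%N; have := ai 0%N; rewrite a0.
  have [nai'|nai'] := ltnP n.+1 (a i.+1); first by exists i; rewrite nai' leqW.
  exists i.+1; rewrite nai' (leq_ltn_trans nai) //.
have b_uniq n i : (a i <= n < a i.+1)%N -> b n = i.
  move=> /andP[ain nai]; have /andP[abn nab] := bP n.
  apply/eqP; rewrite eqn_leq; apply/andP.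
  split; rewrite leqNgt; apply/negP => /amono.
    by move=> /leq_trans /(_ abn); rewrite leqNgt nai.
  by move=> /leq_trans /(_ ain); rewrite leqNgt nab.
have Lsz i : size (L i) = (a i.+1 - a i)%N by rewrite (perm_size (aL i)) size_iota.
have Lmem i m : (m \in L i) = (a i <= m < a i.+1)%N.
  by rewrite (perm_mem (aL i)) mem_index_iota.
have Luniq i : uniq (L i) by rewrite (perm_uniq (aL i)) iota_uniq.
pose s n := nth 0%N (L (b n)) (n - a (b n)).
pose t m := (a (b m) + index m (L (b m)))%N.
have sub_lt n : (n - a (b n) < size (L (b n)))%N.
  by have /andP[h1 h2] := bP n; rewrite Lsz ltn_sub2r // ai.
have bs n : b (s n) = b n by apply: b_uniq; rewrite -Lmem mem_nth.
have bt m : b (t m) = b m.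
  apply: b_uniq; rewrite leq_addr /= -ltn_subRL -Lsz index_mem Lmem.
  exact: bP.
exists s; split=> [|i j jL].
  exists t => [n|m].
    rewrite /t bs index_uniq // addnC subnK //.
    by have /andP[] := bP n.
  by rewrite /s bt /t addKn nth_index // Lmem; exact: bP.
have bE : b (a i + j) = i.
  by apply: b_uniq; rewrite leq_addr /= -ltn_subRL -Lsz.
by rewrite /s bE addKn.
Qed.

Section Unconditional.
Context {R : realType} {H : completeNormedModType R[i]}.
Variable dot : {dot H for (@Num.conj R[i])}.
Hypothesis hdot : induces_norm dot.
Implicit Types (x : nat -> H) (y : H).

(** Otherwise infinitely many disjoint finite subsums stay away from 0, and an
    ordering that lists each of them consecutively has no convergent series. *)
Lemma unconditional_uniform_cauchy x (e : R) :
  unconditionally_summable x -> 0 < e ->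
  exists N, forall n (P : pred nat),
    rnorm (\sum_(N <= k < n | P k) x k) < e.
Proof.
move=> xs e0; apply: contrapT => /forallNP nN.
have /choice[p pP] : forall N, exists p : nat * pred nat,
    e <= rnorm (\sum_(N <= k < p.1 | p.2 k) x k).
  move=> N; have /existsNP[n /existsNP[P /negP]] := nN N.
  by rewrite -leNgt => h; exists (n, P).
have p_gt N : (N < (p N).1)%N.
  rewrite ltnNge; apply/negP => h; have := pP N.
  by rewrite big_geq // rnorm0 leNgt e0.
pose a := fix a i := if i is j.+1 then (p (a j)).1 else 0%N.
pose L i := [seq k <- index_iota (a i) (a i.+1) | (p (a i)).2 k].
pose L' i := [seq k <- index_iota (a i) (a i.+1) | predC (p (a i)).2 k].
have [//|i|i|s [sbij sL]] := @block_permutation a (fun i => L i ++ L' i).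
- exact: p_gt.
- by apply: permEl; exact: perm_filterC.
have a_ge i : (i <= a i)%N.
  by elim: i => // i IH; apply: leq_ltn_trans IH _; exact: p_gt.
have /cauchy_cvgP/cauchy_seriesP/(_ e%:C%C) := xs s sbij.
rewrite ltcR => /(_ e0) [[A B] /= [[N1 _ NA] [N2 _ NB]] AB].
pose i := maxn N1 N2.
have /= := AB (a i, (a i + size (L i))%N).
rewrite -rnormE ltcR => h.
suff : rnorm (\sum_(a i <= k < a i + size (L i)) (x \o s) k) < e.
  apply/negP; rewrite -leNgt; apply: le_trans (pP (a i)) _.
  rewrite le_eqVlt; apply/orP; left; apply/eqP; congr rnorm.
  rewrite -[X in \sum_(X <= k < a i + _) _]add0n big_addn addKn -[LHS]big_filter -/(L i).
  rewrite [LHS](big_nth 0%N) !big_nat; apply: eq_bigr => j /= jL.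
  by rewrite addnC sL ?size_cat ?nth_cat ?jL // ltn_addr.
apply: h; split; first by apply: NA => /=; rewrite (leq_trans _ (a_ge i)) // leq_maxl.
by apply: NB => /=; rewrite (leq_trans _ (leq_addr _ _)) // (leq_trans _ (a_ge i)) // leq_maxr.
Qed.

Lemma unconditional_bounded_subsums x : unconditionally_summable x ->
  exists2 C : R, 0 < C & forall n (P : pred nat),
    rnorm (\sum_(0 <= k < n | P k) x k) <= C.
Proof.
move=> /unconditional_uniform_cauchy/(_ ltr01)[N NP].
have sum0 (m n : nat) : 0 <= \sum_(m <= k < n) rnorm (x k).
  by apply: sumr_ge0 => k _; exact: rnorm_ge0.
have head (P : pred nat) n : (n <= N)%N ->
    rnorm (\sum_(0 <= k < n | P k) x k) <= \sum_(0 <= k < N) rnorm (x k).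
  move=> nN; apply: le_trans (rnorm_sum _ _ _) _.
  rewrite [leRHS](big_cat_nat (leq0n n) nN) /=.
  apply: le_trans (_ : \sum_(0 <= k < n) rnorm (x k) <= _); last by rewrite lerDl.
  rewrite [leRHS](bigID P) /= lerDl.
  by apply: sumr_ge0 => k _; exact: rnorm_ge0.
exists (\sum_(0 <= k < N) rnorm (x k) + 1); first by rewrite ltr_wpDl.
move=> n P; have [nN|/ltnW Nn] := leqP n N.
  by apply: le_trans (head P n nN) _; rewrite lerDl.
rewrite (big_cat_nat (leq0n N) Nn) /=; apply: le_trans (rnormD _ _) _.
by rewrite lerD ?head // ltW.
Qed.

(** Split the sum according to the sign of the terms. *)
Lemma sum_norm_le (phi : nat -> R) n (D : R) :
  (forall P : pred nat, `|\sum_(0 <= k < n | P k) phi k| <= D) ->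
  \sum_(0 <= k < n) `|phi k| <= 2 * D.
Proof.
move=> phiD; rewrite (bigID (fun k => 0 <= phi k)) /= mulr_natl mulr2n lerD //.
  under eq_bigr => k pk do rewrite ger0_norm //.
  by apply: le_trans (phiD _); exact: ler_norm.
under eq_bigr => k pk do rewrite ltr0_norm ?ltNge //.
rewrite sumrN; apply: le_trans (phiD (fun k => ~~ (0 <= phi k))).
by rewrite -normrN ler_norm.
Qed.

(** Bounded subsums make [sum_k |<y, x k>|] at most a multiple of the norm of [y],
    and the sum of the squares is at most the square of the sum. *)
Lemma unconditional_bessel x : unconditionally_summable x -> bessel dot x.
Proof.
move=> /unconditional_bounded_subsums[C C0 xC].
have absum y n : \sum_(0 <= k < n) rnorm (dot y (x k)) <= 4 * C * rnorm y.
  have D P : rnorm (\sum_(0 <= k < n | P k) dot y (x k)) <= C * rnorm y.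
    rewrite -dot_sumr; apply: le_trans (CauchySchwarz hdot _ _) _.
    by rewrite mulrC ler_wpM2r ?rnorm_ge0.
  apply: le_trans (_ : \sum_(0 <= k < n)
      (`|complex.Re (dot y (x k))| + `|complex.Im (dot y (x k))|) <= _).
    by apply: ler_sum => k _; exact: rnorm_le_ReIm.
  rewrite big_split /=.
  have -> : 4 * C * rnorm y = 2 * (C * rnorm y) + 2 * (C * rnorm y) by ring.
  apply: lerD; apply: sum_norm_le => P; apply: le_trans (D P).
    rewrite -(big_morph (@complex.Re R) (id1 := 0) (op1 := +%R) (id2 := 0) (op2 := +%R)) //.
      exact: Re_le_rnorm.
    by move=> [? ?] [? ?].
  rewrite -(big_morph (@complex.Im R) (id1 := 0) (op1 := +%R) (id2 := 0) (op2 := +%R)) //.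
    exact: Im_le_rnorm.
  by move=> [? ?] [? ?].
exists ((4 * C) ^+ 2); split; first by rewrite exprn_gt0 // mulr_gt0.
apply/bessel_boundP => y n; set a := fun k => rnorm (dot y (x k)).
have a0 k : 0 <= a k by exact: rnorm_ge0.
have s0 : 0 <= \sum_(0 <= k < n) a k by apply: sumr_ge0.
rewrite -exprMn; apply: le_trans (_ : (\sum_(0 <= k < n) a k) ^+ 2 <= _).
  rewrite expr2 mulr_suml; apply: ler_sum_nat => k kn.
  rewrite expr2 ler_wpM2l ?rnorm_ge0 //.
  rewrite (bigD1_seq k) ?iota_uniq ?mem_index_iota //= lerDl.
  by apply: sumr_ge0.
by rewrite ler_pXn2r ?nnegrE ?absum // !mulr_ge0 ?rnorm_ge0 // ltW.
Qed.

End Unconditional.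

(** * Consequences of closure under unions *)

Section Closure.
Context {R : realType} {H : completeNormedModType R[i]}.
Variable dot : {dot H for (@Num.conj R[i])}.
Hypothesis hdot : induces_norm dot.
Hypothesis hsep : separable H.
Hypothesis hinf : infinite_dimensional H.
Hypothesis hU : setU_closed [set M : set H | l1_bounded dot M].
Implicit Types (x : H) (e f g r : nat -> H) (M : set H).

Lemma bessel_l1_bounded f : bessel dot f -> l1_bounded dot (range f).
Proof.
move=> fB; have [u ub] := orthonormal_basis_exists hdot hsep hinf.
have [k [e [eb fE]]] := bessel_riesz_decomposition hdot ub fB.
have [r [rb /l1norm_sup_finP[C rC]]] : l1_bounded dot (range e `|` range u).
  apply: hU; apply: (riesz_basis_l1_bounded hdot) => //.
  exact: orthonormal_basis_riesz.
exists r; split=> //; apply/l1norm_sup_finP; exists (C + `|k| * C).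
move=> _ [n _ <-] N.
apply: le_trans (_ : \sum_(0 <= j < N)
    (rnorm (dot (e n) (r j)) + `|k| * rnorm (dot (u n) (r j))) <= _).
  apply: ler_sum => j _; rewrite fE linearDl /= dotZl.
  by apply: le_trans (rnormD _ _) _; rewrite rnormM rnorm_real.
rewrite big_split /= -mulr_sumr lerD //; first by apply: rC; left; exists n.
by rewrite ler_wpM2l //; apply: rC; right; exists n.
Qed.

(** Expand the vectors of [M] in a dual frame, itself a Bessel sequence. *)
Lemma l1_frame_bounded_l1_bounded M :
  l1_frame_bounded dot M -> l1_bounded dot M.
Proof.
move=> [f [ff /l1norm_sup_finP[A MA]]].
have [g [/bessel_l1_bounded[r [rb /l1norm_sup_finP[C gC]]] gE]] := frame_dual hdot ff.
exists r; split=> //; apply/l1norm_sup_finP; exists (A * C) => x Mx.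
apply: (l1_series_le hdot (gE x)); first exact: MA.
by move=> k; apply: gC; exists k.
Qed.

(** Proved with the sharper bound 2 - 1/N, for which the induction closes. *)
Lemma inv_sqr_sum_le N : \sum_(0 <= k < N) (k.+1%:R^-1 : R) ^+ 2 <= 2.
Proof.
suff : \sum_(0 <= k < N.+1) (k.+1%:R^-1 : R) ^+ 2 <= 2 - N.+1%:R^-1.
  rewrite big_nat_recr //= => h; apply: le_trans (_ : _ <= 2 - N.+1%:R^-1) _.
    by apply: le_trans h; rewrite lerDl sqr_ge0.
  by rewrite gerBl invr_ge0.
elim: N => [|N IH]; first by rewrite big_nat1 invr1 expr1n; lra.
rewrite big_nat_recr //=; apply: le_trans (lerD IH (lexx _)) _.
have a0 : 0 < N.+1%:R :> R by [].
rewrite [N.+2%:R]mulrS; move: (N.+1%:R : R) a0 => a a0.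
rewrite -subr_ge0.
have -> : 2 - (1 + a)^-1 - (2 - a^-1 + (1 + a)^-1 ^+ 2) = a^-1 * (1 + a)^-1 ^+ 2.
  by field; rewrite !gt_eqF // addr_gt0.
by rewrite mulr_ge0 ?sqr_ge0 // invr_ge0 ltW.
Qed.

(** The vector with harmonic coefficients with respect to the biorthogonal basis
    is outside the l1 space of [e]; together with that basis it forms
    a Bessel sequence. *)
Lemma l1space_proper_extension e : riesz_basis dot e ->
  exists r, riesz_basis dot r /\ l1space dot e `<` l1space dot r.
Proof.
move=> eb; have [h [_ _ hB eh hE]] := riesz_basis_dual hdot eb.
pose c n : R[i] := (n.+1%:R^-1)%:C%C.
have cE n : rnorm (c n) = n.+1%:R^-1.
  by rewrite /c rnorm_real ger0_norm // invr_ge0.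
have yc : cvgn (series (fun n => c n *: h n)).
  apply: (bessel_series_cvg hdot hB (M := 2)) => N.
  under eq_bigr do rewrite cE.
  exact: inv_sqr_sum_le.
set y := limn (series (fun n => c n *: h n)) in yc.
have yE m : dot y (e m) = c m.
  have he i j : dot (h i) (e j) = (i == j)%:R.
    by rewrite dotC eh conjC_nat eq_sym.
  have := cvg_dotl hdot (y := e m) yc => yl.
  apply: (cvg_unique _ yl) => //; apply/cvg_rnormP => d d0.
  exists m.+1 => // n /= mn.
  by rewrite /series /= (dot_synth _ _ _ he) mn subrr rnorm0.
have yN : ~ l1space dot e y.
  move=> /l1spaceP[C yC]; apply: (@dvg_harmonic R).
  apply: nondecreasing_is_cvgn.
    by apply: nondecreasing_series => k _; rewrite invr_ge0.
  exists C => _ [N _ <-]; apply: le_trans (yC N).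
  by rewrite /series /=; apply: ler_sum => k _; rewrite yE cE.
pose f n := if n is k.+1 then h k else y.
have [B [B0 /bessel_boundP hBB]] := hB.
have fB : bessel dot f.
  exists (rnorm y ^+ 2 + B); split; first by rewrite ltr_wpDl // sqr_ge0.
  apply/bessel_boundP => x [|N].
    by rewrite big_geq // mulr_ge0 ?addr_ge0 ?sqr_ge0 ?(ltW B0).
  rewrite big_nat_recl //= mulrDl lerD // -exprMn.
  by rewrite ler_pXn2r ?nnegrE ?mulr_ge0 ?rnorm_ge0 // mulrC CauchySchwarz.
have [r [rb /l1norm_sup_finP[C rC]]] := bessel_l1_bounded fB.
exists r; split=> //; split=> [x /l1spaceP[A xA]|er].
  apply/l1spaceP; exists (A * C); apply: (l1_series_le hdot (hE x)) xA _.
  by move=> k; apply: rC; exists k.+1.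
by apply/yN/er/l1spaceP; exists C; apply: rC; exists 0%N.
Qed.

End Closure.

Theorem theorem4p12 (R : realType) (H : completeNormedModType R[i])
    (dot : {dot H for (@Num.conj R[i])}) (hdot : induces_norm dot)
    (hsep : separable H) (hinf : infinite_dimensional H)
    (hU : setU_closed [set M : set H | l1_bounded dot M]) :
  [/\ (* (a) *)
      (forall x : nat -> H, bessel dot x -> l1_bounded dot (range x)) /\
      (forall x : nat -> H, frame dot x -> l1_bounded dot (range x)),
      (* (b) *)
      forall M : set H, l1_frame_bounded dot M <-> l1_bounded dot M,
      (* (c) *)
      forall e : nat -> H, riesz_basis dot e ->
        exists r : nat -> H,
          riesz_basis dot r /\ l1space dot e `<` l1space dot r
    & (* (d) *)
      forall x : nat -> H, unconditionally_summable x ->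
        l1_bounded dot (range x)].
Proof.
have Bl1 := bessel_l1_bounded hdot hsep hinf hU.
split.
- by split=> [//|x [A [B [A0 AB xB _]]]]; apply: Bl1; exists B; rewrite (lt_le_trans A0).
- move=> M; split; first exact: l1_frame_bounded_l1_bounded.
  by move=> [e [eb Me]]; exists e; split=> //; exact: riesz_basis_frame.
- exact: l1space_proper_extension.
- by move=> x /(unconditional_bessel hdot); exact: Bl1.
Qed.
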